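(* Let $(f_a)_{a\in\mathcal V}$ be a soft Multi-GM over a finite multi-graph $\mathcal G=(\mathcal V,\mathcal E)$, and let $\alpha^{(1)},\dots,\alpha^{(k)}$ be a sequence of edges such that, in the edge-elimination sequence, each $\alpha^{(m)}$ is a normal edge of $\mathcal G^{(m-1)}$ and $\mathcal G^{(k)}$ is a bouquet graph (a single node, all remaining edges being self-edges). Then eliminating $\alpha^{(1)},\dots,\alpha^{(k)}$ one by one by the BP-gauge procedure is exact, i.e. equivalent to exact elimination by summation over the binary variables of the eliminated edges: if $g^{(0)}=h$ and, for $m=1,\dots,k$, $g^{(m)}$ is the BP-reduction of $g^{(m-1)}$ over the edge $\alpha^{(m)}$, then for every $m=0,\dots,k$ $$g^{(m)}(x^{(m)})=h^{(m)}(x^{(m)})\quad\text{for all positive } x^{(m)},$$ where $h^{(m)}$ is the polynomial of the $m$-th Multi-GM of the (exact) edge-elimination sequence.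
   Context: Multi-graph notation. $\mathcal G=(\mathcal V,\mathcal E)$ is a finite undirected multi-graph; multiple edges and self-edges are allowed. Each $\alpha\in\mathcal E$ has two directed versions, $\alpha_d$ and its reverse $\bar\alpha_d$; $\mathcal E_d$ is the set of all directed edges. Each directed edge is attached to exactly one node: for an edge joining two distinct nodes (a normal edge) one of its two directed versions is attached to each end node; for a self-edge both directed versions are attached to its node. $e_d(a)$ is the set of directed edges attached to node $a$, and $\Sigma_a=\{0,1\}^{e_d(a)}$. Multi-GM. Factors $f_a:\Sigma_a\to[0,\infty)$, $a\in\mathcal V$; soft means $f_a(s)>0$ for all $a,s$. Variables $x=(x_\gamma)_{\gamma\in\mathcal E_d}$; its polynomial is $h(x)=\prod_{a\in\mathcal V}\sum_{s\in\Sigma_a}f_a(s)\prod_{\gamma\in e_d(a)}x_\gamma^{s_\gamma}$. Exact edge-elimination sequence. Start with $\mathcal G^{(0)}=\mathcal G$, $f^{(0)}_a=f_a$. At step $m$, the normal edge $\alpha=\alpha^{(m)}$ joining $b\neq c$ in $\mathcal G^{(m-1)}$ is contracted: it is removed, and $b,c$ are merged into one node $a$ with $e_d^{(m)}(a)=(e_d^{(m-1)}(b)\cup e_d^{(m-1)}(c))\setminus\{\alpha_d,\bar\alpha_d\}$ and factor $f_a^{(m)}(s)=\sum_{\tau\in\{0,1\}}f_b^{(m-1)}(s|_b,\tau)\,f_c^{(m-1)}(s|_c,\tau)$, where $\tau$ is the value on the directed version of $\alpha$ attached to $b$, resp. $c$; other factors are unchanged. $x^{(m)}$ is $x$ with the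 variables of $\alpha^{(1)},\dots,\alpha^{(m)}$ removed, and $h^{(m)}(x^{(m)})$ is the polynomial of the $m$-th Multi-GM. BP-reduction. Let $g$ be a polynomial that is of degree at most one in each of $x_{\alpha_d}$, $x_{\bar\alpha_d}$: $g=g^{(0,0)}+g^{(1,0)}x_{\alpha_d}+g^{(0,1)}x_{\bar\alpha_d}+g^{(1,1)}x_{\alpha_d}x_{\bar\alpha_d}$, with coefficients $g^{(i,j)}$ depending on the remaining (positive) variables. The $\alpha$-BP gauge is the solution $$x_{\alpha_d}^{(\alpha\text{-bp})}=\frac{D}{2g^{(1,0)}},\quad x_{\bar\alpha_d}^{(\alpha\text{-bp})}=\frac{D}{2g^{(0,1)}},\quad D=g^{(1,1)}-g^{(0,0)}+\sqrt{(g^{(1,1)}-g^{(0,0)})^2+4g^{(0,1)}g^{(1,0)}},$$ of the stationarity equations $\partial_{x_{\alpha_d}}\frac{g}{1+x_{\alpha_d}x_{\bar\alpha_d}}=\partial_{x_{\bar\alpha_d}}\frac{g}{1+x_{\alpha_d}x_{\bar\alpha_d}}=0$ with positive components. The BP-reduction of $g$ over $\alpha$ is the function of the remaining variables given by $\frac{g}{1+x_{\alpha_d}x_{\bar\alpha_d}}$ evaluated at the $\alpha$-BP gauge. *)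

(* Defs.v *)
From HB Require Import structures.
From mathcomp Require Import all_boot all_order all_algebra.
From mathcomp Require Import ring lra.
From mathcomp Require Import boolp classical_sets reals topology normedtype derive.

Set Implicit Arguments.
Unset Strict Implicit.
Unset Printing Implicit Defensive.

Import Order.TTheory GRing.Theory Num.Theory.
Import numFieldNormedType.Exports.

Local Open Scope ring_scope.

(* The two directed versions of an edge [e] are [(e, false)] and [(e, true)]. *)
Definition dedge (E : finType) : finType := (E * bool)%type.

(* [V] and [E] are ambient name spaces, so that all the multi-graphs of an
   elimination sequence live in the same type; [node_of] is only meaningful on
   the directed versions of members of [edges]. *)
Record multigraph (V E : finType) := Multigraph {
  nodes : {set V};
  edges : {set E};
  node_of : dedge E -> V;
  node_ofP : forall g : dedge E, g.1 \in edges -> node_of g \in nodes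
}.

Section Multigraph.
Variables V E : finType.
Implicit Types (G : multigraph V E) (e : E) (a v : V) (g : dedge E).

Definition normal_edge G e : bool :=
  (e \in edges G) && (node_of G (e, false) != node_of G (e, true)).

Definition self_edge G e : bool :=
  (e \in edges G) && (node_of G (e, false) == node_of G (e, true)).

Definition attached G a : {set dedge E} :=
  [set g : dedge E | (g.1 \in edges G) && (node_of G g == a)].

Definition bouquet G : bool :=
  (#|nodes G| == 1)%N && [forall e in edges G, self_edge G e].

(* The node resulting from merging the end nodes of [e] takes over the name of
   the end node to which [(e, false)] is attached. *)
Definition merge G e v : V :=
  if v == node_of G (e, true) then node_of G (e, false) else v.

Lemma contract_node_ofP G e g :
  g.1 \in edges G :\ e -> merge G e (node_of G g) \in merge G e @: nodes G.
Proof. by case/setD1P=> _ /node_ofP; apply: imset_f. Qed.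

Definition contract_graph G e : multigraph V E :=
  @Multigraph V E (merge G e @: nodes G) (edges G :\ e)
    (fun g => merge G e (node_of G g)) (@contract_node_ofP G e).

Lemma nodes_contract G e :
  normal_edge G e ->
  nodes (contract_graph G e) = nodes G :\ node_of G (e, true).
Proof.
case/andP=> eG nbc; apply/setP=> v; apply/imsetP/setD1P => [[w wG ->]|[vc vG]].
  rewrite /merge; case: (eqVneq w) => [_|wc]; last by split.
  by split=> //; apply: node_ofP.
by exists v => //; rewrite /merge (negPf vc).
Qed.

Lemma attached_contract G e :
  normal_edge G e ->
  attached (contract_graph G e) (node_of G (e, false)) =
  (attached G (node_of G (e, false)) :|: attached G (node_of G (e, true)))
    :\: [set (e, false); (e, true)].
Proof.
case/andP=> eG nbc; apply/setP=> -[d i]; rewrite !inE /= /merge !xpair_eqE.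
case: (eqVneq d e) => [->|_] /=; first by case: i.
case: (d \in edges G) => //=.
by case: (eqVneq (node_of G (d, i)) (node_of G (e, true))); rewrite ?eqxx ?orbT ?orbF.
Qed.

Lemma attached_contract_other G e a :
  normal_edge G e -> a != node_of G (e, false) -> a != node_of G (e, true) ->
  attached (contract_graph G e) a = attached G a.
Proof.
case/andP=> eG nbc ab ac; apply/setP=> -[d i]; rewrite !inE /= /merge.
case: (eqVneq d e) => [->|_] /=.
  by rewrite eG; case: i; rewrite eq_sym ?(negPf ab) ?(negPf ac).
case: (d \in edges G) => //=.
case: (eqVneq (node_of G (d, i)) (node_of G (e, true))) => [->|//].
by rewrite eq_sym (negPf ab) eq_sym (negPf ac).
Qed.

End Multigraph.

(* A configuration in {0,1}^(attached G a) is encoded as the subset of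
   [attached G a] on which it takes the value 1; the values of [factor a] at
   other sets are irrelevant. *)
Record multiGM (R : realType) (V E : finType) := MultiGM {
  graph_of :> multigraph V E;
  factor : V -> {set dedge E} -> R
}.

Section MultiGM.
Variables (R : realType) (V E : finType).
Implicit Types (M : multiGM R V E) (e : E) (x : dedge E -> R).

(* Softness includes the standing assumption that factors are nonnegative. *)
Definition soft M : Prop :=
  forall a (s : {set dedge E}),
    a \in nodes M -> s \subset attached M a -> 0 < factor M a s.

Definition hpoly M x : R :=
  \prod_(a in nodes M)
    \sum_(s in powerset (attached M a))
      factor M a s * \prod_(g in attached M a) x g ^+ (g \in s).

(* [with_bit s g t] extends the configuration [s] by the value [t] at [g]. *)
Definition with_bit (s : {set dedge E}) (g : dedge E) (t : bool) : {set dedge E} :=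
  if t then g |: s else s.

Definition contract_factor M e (a : V) (s : {set dedge E}) : R :=
  let b := node_of M (e, false) in
  let c := node_of M (e, true) in
  if a == b then
    \sum_(t : bool)
      factor M b (with_bit (s :&: attached M b) (e, false) t) *
      factor M c (with_bit (s :&: attached M c) (e, true) t)
  else factor M a s.

Definition contract M e : multiGM R V E :=
  MultiGM (contract_graph M e) (contract_factor M e).

Definition eliminate M (s : seq E) : multiGM R V E := foldl contract M s.

End MultiGM.

(* Coefficients of c00 + c10 y + c01 z + c11 y z. *)
Record bicoef (R : Type) := BiCoef { c00 : R; c10 : R; c01 : R; c11 : R }.

Section BPGauge.
Variable R : realType.
Implicit Types (c : bicoef R) (y z : R).

Definition bival c y z : R := c00 c + c10 c * y + c01 c * z + c11 c * y * z.

Definition bp_D c : R :=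
  c11 c - c00 c + Num.sqrt ((c11 c - c00 c) ^+ 2 + 4 * c01 c * c10 c).

Definition bp_gauge c : R * R :=
  (bp_D c / (2 * c10 c), bp_D c / (2 * c01 c)).

Lemma quadratic_pos_root (a b d z : R) : 0 < a -> 0 < b ->
  z = (d + Num.sqrt (d ^+ 2 + 4 * a * b)) / (2 * a) <->
  0 < z /\ a * z ^+ 2 - d * z - b = 0.
Proof.
move=> a0 b0; set S := Num.sqrt _.
have ab0 : 0 < a * b by apply: mulr_gt0.
have SS : S ^+ 2 = d ^+ 2 + 4 * a * b by rewrite sqr_sqrtr //; nra.
have dS : `|d| < S.
  by rewrite -(@ltr_pXn2r _ 2%N) ?nnegrE ?sqrtr_ge0 // real_normK ?num_real // SS; nra.
move: dS; rewrite ltr_norml => /andP[Sd dS].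
split=> [zE|[z0 zE]].
  have z2 : 2 * a * z = d + S by rewrite zE; field; rewrite gt_eqF.
  have dS0 : 0 < d + S by lra.
  have az : 0 < 2 * a * z by rewrite z2.
  split; first by rewrite -(@pmulr_rgt0 _ (2 * a)) //; lra.
  apply: (@mulfI _ (4 * a)); first by rewrite gt_eqF //; lra.
  rewrite mulr0.
  have -> : 4 * a * (a * z ^+ 2 - d * z - b) =
    (2 * a * z) ^+ 2 - 2 * d * (2 * a * z) - 4 * a * b by ring.
  by rewrite z2; ring: SS.
have SE : (2 * a * z - d) ^+ 2 = S ^+ 2.
  have -> : (2 * a * z - d) ^+ 2 =
    4 * a * (a * z ^+ 2 - d * z - b) + (d ^+ 2 + 4 * a * b) by ring.
  by rewrite zE mulr0 add0r SS.
have /eqP := SE; rewrite eqf_sqr => /orP[] /eqP E.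
  by rewrite -E; field; rewrite gt_eqF.
have az : 0 < a * z by apply: mulr_gt0.
by exfalso; lra.
Qed.

Lemma is_derive_frac (p q r t : R) : 1 + r * t != 0 ->
  is_derive t 1 (fun t => (p + q * t) / (1 + r * t))
    ((q - r * p) / (1 + r * t) ^+ 2).
Proof.
move=> rt0.
have H : is_derive t (1 : R) (fun t : R => (1 + r * t)^-1) (- (1 + r * t) ^- 2 * r).
  have D : is_derive t (1 : R) (fun t : R => 1 + r * t) r.
    by apply: is_derive_eq; rewrite /GRing.scale /= ?mulr1 ?mulr0 ?addr0 ?add0r //; try ring.
  have D1 : derivable (fun t : R => 1 + r * t) t 1 by apply: ex_derive.
  apply: DeriveDef; first exact: derivableV.
  by rewrite deriveV // derive_val.
apply: is_derive_eq; rewrite /GRing.scale /=; field.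
exact: rt0.
Qed.

(* The gauge is the unique positive stationary point of g / (1 + y z). *)
Lemma bp_gaugeP c y z : 0 < c10 c -> 0 < c01 c ->
  (y, z) = bp_gauge c <->
  [/\ 0 < y, 0 < z,
      is_derive y 1 (fun t => bival c t z / (1 + t * z)) 0 &
      is_derive z 1 (fun t => bival c y t / (1 + y * t)) 0].
Proof.
move=> h10 h01.
have Hy : y = bp_D c / (2 * c10 c) <->
    0 < y /\ c10 c * y ^+ 2 - (c11 c - c00 c) * y - c01 c = 0.
  rewrite -quadratic_pos_root // /bp_D.
  by have -> : 4 * c01 c * c10 c = 4 * c10 c * c01 c by ring.
have Hz : z = bp_D c / (2 * c01 c) <->
    0 < z /\ c01 c * z ^+ 2 - (c11 c - c00 c) * z - c10 c = 0.
  by rewrite -quadratic_pos_root.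
have num0 (p q : R) : q != 0 -> (p / q = 0) <-> p = 0.
  move=> q0; split=> [/eqP|->]; last by rewrite mul0r.
  by rewrite mulf_eq0 invr_eq0 (negPf q0) orbF => /eqP.
have Dy : 0 < y -> 0 < z ->
    is_derive y 1 (fun t => bival c t z / (1 + t * z)) 0 <->
    c01 c * z ^+ 2 - (c11 c - c00 c) * z - c10 c = 0.
  move=> y0 z0; have yz : 1 + z * y != 0 by rewrite gt_eqF //; nra.
  have -> : (fun t => bival c t z / (1 + t * z)) =
      (fun t => (c00 c + c01 c * z + (c10 c + c11 c * z) * t) / (1 + z * t)).
    by apply: funext => t; rewrite /bival; congr (_ / _); ring.
  have D := is_derive_frac (c00 c + c01 c * z) (c10 c + c11 c * z) yz.
  split=> [D0|E].
    have : (c10 c + c11 c * z - z * (c00 c + c01 c * z)) / (1 + z * y) ^+ 2 = 0.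
      by rewrite -(@derive_val _ _ _ _ _ _ _ D) (@derive_val _ _ _ _ _ _ _ D0).
    by rewrite num0 ?expf_neq0 // => E; lra.
  by apply: is_derive_eq; apply/num0; rewrite ?expf_neq0 //; lra.
have Dz : 0 < y -> 0 < z ->
    is_derive z 1 (fun t => bival c y t / (1 + y * t)) 0 <->
    c10 c * y ^+ 2 - (c11 c - c00 c) * y - c01 c = 0.
  move=> y0 z0; have yz : 1 + y * z != 0 by rewrite gt_eqF //; nra.
  have -> : (fun t => bival c y t / (1 + y * t)) =
      (fun t => (c00 c + c10 c * y + (c01 c + c11 c * y) * t) / (1 + y * t)).
    by apply: funext => t; rewrite /bival; congr (_ / _); ring.
  have D := is_derive_frac (c00 c + c10 c * y) (c01 c + c11 c * y) yz.
  split=> [D0|E].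
    have : (c01 c + c11 c * y - y * (c00 c + c10 c * y)) / (1 + y * z) ^+ 2 = 0.
      by rewrite -(@derive_val _ _ _ _ _ _ _ D) (@derive_val _ _ _ _ _ _ _ D0).
    by rewrite num0 ?expf_neq0 // => E; lra.
  by apply: is_derive_eq; apply/num0; rewrite ?expf_neq0 //; lra.
rewrite /bp_gauge; split=> [[/Hy[y0 Ey] /Hz[z0 Ez]]|[y0 z0 /(Dy y0 z0) Ez /(Dz y0 z0) Ey]].
  by split=> //; [apply/Dy|apply/Dz].
by congr (_, _); [apply/Hy|apply/Hz].
Qed.

End BPGauge.

Section BPReduction.
Variables (R : realType) (E : finType).
(* Functions of the variables left after some eliminations are represented as
   functions of all the variables, the eliminated ones being dummies. *)
Implicit Types (h : (dedge E -> R) -> R) (x : dedge E -> R) (e : E).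

Definition positive x : Prop := forall g, 0 < x g.

Definition set_edge x e (yz : R * R) : dedge E -> R :=
  fun g => if g.1 == e then (if g.2 then yz.2 else yz.1) else x g.

(* [h] has degree at most one in each variable of [e], with coefficients [c]
   depending only on the other variables. *)
Definition has_coefs h e (c : (dedge E -> R) -> bicoef R) : Prop :=
  (forall x x', (forall g, g.1 != e -> x g = x' g) -> c x = c x') /\
  (forall x, positive x -> h x = bival (c x) (x (e, false)) (x (e, true))).

Definition bp_reduction h e (h' : (dedge E -> R) -> R) : Prop :=
  exists2 c, has_coefs h e c &
    forall x, positive x ->
      let yz := bp_gauge (c x) in
      h' x = h (set_edge x e yz) / (1 + yz.1 * yz.2).

End BPReduction.

(* [g] is determined on positive arguments only, hence a relation; [g m.+1] is
   the function obtained by eliminating the edges [alpha_0, ..., alpha_m]. *)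
Definition bp_elimination (R : realType) (V E : finType) (M : multiGM R V E)
    (k : nat) (alpha : k.-tuple E) (g : nat -> (dedge E -> R) -> R) : Prop :=
  (forall x, positive x -> g 0%N x = hpoly M x) /\
  (forall m : 'I_k, bp_reduction (g m) (tnth alpha m) (g m.+1)).

(* Main.v *)
Require Import Defs.
From mathcomp Require Import all_boot all_order all_algebra.
From mathcomp Require Import reals.
From mathcomp Require Import ring lra.

Set Implicit Arguments.
Unset Strict Implicit.
Unset Printing Implicit Defensive.

Import Order.TTheory GRing.Theory Num.Theory.

Local Open Scope ring_scope.

(** If [e] joins [b] and [c], only the factors at [b] and [c] involve the
    variables [y], [z] of [e], so the polynomial is [(B0 + B1 y) (C0 + C1 z) P],
    whereas the polynomial of the contraction is [(B0 C0 + B1 C1) P]. For such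
    a rank-one matrix of coefficients the discriminant in the BP gauge is the
    perfect square [(B1 C1 + B0 C0)^2 P^2]; the gauge is [y = C1 / C0],
    [z = B1 / B0], and substituting it yields exactly [(B0 C0 + B1 C1) P].
    Contraction preserves softness, so this applies at each step. *)

(** * Generating polynomials of functions on the subsets of a finite set *)

Section GeneratingPolynomial.
Variables (R : comNzRingType) (T : finType).
Implicit Types (A B s : {set T}) (F H : {set T} -> R) (x : T -> R) (g : T).

(** The factor of [hpoly] at one node, over an arbitrary index set so that edge variables can be
    split off. *)
Definition genpoly A F x : R :=
  \sum_(s in powerset A) F s * \prod_(g in A) x g ^+ (g \in s).

Lemma eq_genpoly A F H x x' :
  (forall s, s \subset A -> F s = H s) -> {in A, x =1 x'} ->
  genpoly A F x = genpoly A H x'.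
Proof.
move=> FH xx'; apply: eq_bigr => s; rewrite powersetE => sA.
by rewrite FH //; congr (_ * _); apply: eq_bigr => g gA; rewrite xx'.
Qed.

Lemma genpolyD A F H x :
  genpoly A (fun s => F s + H s) x = genpoly A F x + genpoly A H x.
Proof. by rewrite -big_split; apply: eq_bigr => s _; rewrite mulrDl. Qed.

(** A subset of a disjoint union amounts to the pair of its traces on [A] and [B], so the sum
    factors. *)
Lemma genpoly_setU A B F H x : [disjoint A & B] ->
  genpoly (A :|: B) (fun s => F (s :&: A) * H (s :&: B)) x =
  genpoly A F x * genpoly B H x.
Proof.
move=> dAB; rewrite /genpoly big_distrlr pair_big /=.
rewrite (reindex_onto (fun p : {set T} * {set T} => p.1 :|: p.2)
  (fun s => (s :&: A, s :&: B))) /=; last first.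
  by move=> s; rewrite powersetE -setIUr => /setIidPl.
apply: eq_big => [[s t]|[s t]] /=; rewrite !powersetE.
  apply/andP/andP => [[_ /eqP[<- <-]]|[sA tB]].
    by rewrite !subsetIr.
  split; first by rewrite setUSS.
  rewrite !setIUl (setIidPl sA) (setIidPl tB).
  have -> : t :&: A = set0.
    by apply/eqP; rewrite setI_eq0 disjoint_sym; apply: disjointWr tB dAB.
  have -> : s :&: B = set0.
    by apply/eqP; rewrite setI_eq0; apply: disjointWl sA dAB.
  by rewrite setU0 set0U eqxx.
case/andP=> _ /eqP[sA tB]; rewrite sA tB mulrACA; congr (_ * _).
rewrite (big_setID A) /= setUK setDUl setDv set0U.
rewrite (setDidPl _); last by rewrite disjoint_sym.
congr (_ * _).
  by apply: eq_bigr => g gA; rewrite -{2}sA in_setI gA andbT.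
by apply: eq_bigr => g gB; rewrite -{2}tB in_setI gB andbT.
Qed.

(** Split the subsets of [A] by whether they contain [g]; those that do are the sets [g |: s] with
    [s] inside [A :\ g]. *)
Lemma genpoly_setD1 A F x g : g \in A ->
  genpoly A F x =
  genpoly (A :\ g) F x + genpoly (A :\ g) (fun s => F (g |: s)) x * x g.
Proof.
move=> gA; rewrite /genpoly (bigID (fun s => g \in s)) /= addrC; congr (_ + _).
  apply: eq_big => s; first by rewrite !powersetE subsetD1.
  case/andP=> _ /negPf gs.
  by rewrite (big_setD1 g) //= gs expr0 mul1r.
rewrite (reindex_onto (fun s => g |: s) (fun s => s :\ g)) /=; last first.
  by move=> s /andP[_ gs]; rewrite setD1K.
rewrite big_distrl /=; apply: eq_big => s.
  rewrite !powersetE setU11 andbT subUset sub1set gA /= subsetD1.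
  congr (_ && _); apply/eqP/idP => [<-|gs]; last by rewrite setU1K.
  by rewrite setD11.
move=> _; rewrite -mulrA (big_setD1 g) //= setU11 expr1; congr (_ * _).
rewrite mulrC; congr (_ * _); apply: eq_bigr => h /setD1P[hg _].
by rewrite in_setU1 (negPf hg).
Qed.

End GeneratingPolynomial.

Lemma genpoly_gt0 (R : realDomainType) (T : finType) (A : {set T})
    (F : {set T} -> R) (x : T -> R) :
  (forall s : {set T}, s \subset A -> 0 < F s) -> {in A, forall g, 0 < x g} ->
  0 < genpoly A F x.
Proof.
move=> F0 x0; have t0 (s : {set T}) : s \subset A ->
    0 < F s * \prod_(g in A) x g ^+ (g \in s).
  move=> sA; rewrite mulr_gt0 ?F0 // prodr_gt0 // => g gA.
  by rewrite exprn_gt0 ?x0.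
(* The empty set indexes a positive term whatever [A] is, so nonnegativity of the others
   suffices. *)
rewrite /genpoly (bigD1 set0) /= ?powersetE ?sub0set //.
rewrite ltr_pwDl ?t0 ?sub0set // sumr_ge0 // => s.
by rewrite powersetE => /andP[sA _]; rewrite ltW ?t0.
Qed.

(** * The BP gauge for rank-one coefficients *)

Section SeparableBP.
Variable R : realType.
Implicit Types c : bicoef R.

Definition sep_coef (b0 b1 c0 c1 p : R) : bicoef R :=
  BiCoef (b0 * c0 * p) (b1 * c0 * p) (b0 * c1 * p) (b1 * c1 * p).

Lemma bival_sep (b0 b1 c0 c1 p y z : R) :
  bival (sep_coef b0 b1 c0 c1 p) y z = (b0 + b1 * y) * (c0 + c1 * z) * p.
Proof. by rewrite /bival /=; ring. Qed.

Lemma bp_gauge_sep (b0 b1 c0 c1 p : R) :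
  0 < b0 -> 0 < b1 -> 0 < c0 -> 0 < c1 -> 0 < p ->
  bp_gauge (sep_coef b0 b1 c0 c1 p) = (c1 / c0, b1 / b0).
Proof.
move=> b00 b10 c00 c10 p0.
have D : bp_D (sep_coef b0 b1 c0 c1 p) = 2 * (b1 * c1 * p).
  rewrite /bp_D /=.
  (* Rank one makes the product of the off-diagonal coefficients equal to that of the diagonal ones,
     and [(u - v)^2 + 4 u v = (u + v)^2]. *)
  have -> : (b1 * c1 * p - b0 * c0 * p) ^+ 2
      + 4 * (b0 * c1 * p) * (b1 * c0 * p) =
    (b1 * c1 * p + b0 * c0 * p) ^+ 2 by ring.
  by rewrite sqrtr_sqr gtr0_norm ?addr_gt0 ?mulr_gt0 //; ring.
rewrite /bp_gauge D /=; congr (_, _); field; by rewrite !gt_eqF.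
Qed.

(** With [S = b0 c0 + b1 c1], the numerator is [S^2 p / (b0 c0)] and the denominator
    [S / (b0 c0)]. *)
Lemma bival_sep_gauge (b0 b1 c0 c1 p : R) :
  0 < b0 -> 0 < b1 -> 0 < c0 -> 0 < c1 ->
  bival (sep_coef b0 b1 c0 c1 p) (c1 / c0) (b1 / b0)
    / (1 + c1 / c0 * (b1 / b0)) = (b0 * c0 + b1 * c1) * p.
Proof.
move=> b00 b10 c00 c10; rewrite bival_sep; field.
by rewrite !gt_eqF ?addr_gt0 ?mulr_gt0.
Qed.

Lemma bival_inj c c' :
  (forall y z, 0 < y -> 0 < z -> bival c y z = bival c' y z) -> c = c'.
Proof.
case: c c' => [a1 a2 a3 a4] [b1 b2 b3 b4] H.
(* A polynomial of degree at most one in each variable is determined by its values on a 2 by 2 grid;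
   here the grid is [{1, 2}^2], inside the positive quadrant. *)
have p1 : 0 < 1 :> R by []. have p2 : 0 < 2 :> R by [].
have := (H 1 1 p1 p1, H 1 2 p1 p2, H 2 1 p2 p1, H 2 2 p2 p2).
rewrite /bival /= => -[[[h1 h2] h3] h4].
by congr BiCoef; lra.
Qed.

End SeparableBP.

(** * BP-reduction and contraction of a single edge *)

Section Elimination.
Variables (R : realType) (V E : finType).
Implicit Types (M : multiGM R V E) (e : E) (x : dedge E -> R) (i t : bool).

Lemma positive_set_edge x e (yz : R * R) :
  positive x -> 0 < yz.1 -> 0 < yz.2 -> positive (set_edge x e yz).
Proof. by move=> x0 y0 z0 [d i]; rewrite /set_edge /=; case: ifP; case: i. Qed.

(** Coefficients ignore the variables of [e], so these can range over all positive values with the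
    rest of [x] fixed, and [bival_inj] applies. *)
Lemma has_coefs_unique (h h' : (dedge E -> R) -> R) e
    (c c' : (dedge E -> R) -> bicoef R) x :
  (forall x, positive x -> h x = h' x) ->
  has_coefs h e c -> has_coefs h' e c' -> positive x -> c x = c' x.
Proof.
move=> hh' [ce ch] [ce' ch'] x0; apply: bival_inj => y z y0 z0.
have q0 : positive (set_edge x e (y, z)) by apply: positive_set_edge.
have q : forall g, g.1 != e -> x g = set_edge x e (y, z) g.
  by move=> g /negPf ge; rewrite /set_edge ge.
have := ch _ q0; rewrite (hh' _ q0) (ch' _ q0) -(ce _ _ q) -(ce' _ _ q).
by rewrite /set_edge /= eqxx.
Qed.

(** Makes the relation [bp_reduction] single-valued on positive arguments. Positivity of the gauge
    keeps the evaluation point where [h1] and [h2] agree. *)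
Lemma bp_reduction_unique (h1 h2 h1' h2' : (dedge E -> R) -> R) e :
  (forall x, positive x -> h1 x = h2 x) ->
  (forall c x, has_coefs h2 e c -> positive x ->
    0 < (bp_gauge (c x)).1 /\ 0 < (bp_gauge (c x)).2) ->
  bp_reduction h1 e h1' -> bp_reduction h2 e h2' ->
  forall x, positive x -> h1' x = h2' x.
Proof.
move=> h12 gauge_gt0 [c1 hc1 H1] [c2 hc2 H2] x x0.
rewrite H1 // H2 // (has_coefs_unique h12 hc1 hc2 x0).
have [y0 z0] := gauge_gt0 _ _ hc2 x0.
by congr (_ / _); apply/h12/positive_set_edge.
Qed.

(* The coefficient of [x (e, i) ^+ t] in the factor polynomial at the node of
   [(e, i)]. *)
Definition half_coef M e i t x : R :=
  let a := node_of M (e, i) in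
  genpoly (attached M a :\ (e, i))
    (fun s => factor M a (with_bit s (e, i) t)) x.

Definition rest_poly M e x : R :=
  \prod_(a in nodes M :\ node_of M (e, true) :\ node_of M (e, false))
    genpoly (attached M a) (factor M a) x.

Definition edge_coefs M e x : bicoef R :=
  sep_coef (half_coef M e false false x) (half_coef M e false true x)
    (half_coef M e true false x) (half_coef M e true true x)
    (rest_poly M e x).

Lemma in_attached M e i : normal_edge M e ->
  (e, i) \in attached M (node_of M (e, i)).
Proof. by case/andP=> eM _; rewrite inE eM eqxx. Qed.

Lemma attached_edgeE M e i j : normal_edge M e ->
  ((e, i) \in attached M (node_of M (e, j))) = (i == j).
Proof. by case/andP=> eM /negPf bc; rewrite inE eM; case: i j => [] [] /=;
  rewrite ?eqxx // eq_sym ?bc // eq_sym bc. Qed.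

(** The ends of a normal edge are distinct nodes, so its two variables occur in different factors of
    the product, each affine in its own variable. *)
Lemma hpoly_split M e x : normal_edge M e ->
  hpoly M x = bival (edge_coefs M e x) (x (e, false)) (x (e, true)).
Proof.
move=> ne; have /andP[eM bc] := ne.
have nodeM i : node_of M (e, i) \in nodes M by apply: node_ofP.
rewrite bival_sep /hpoly (big_setD1 (node_of M (e, true))) //=.
rewrite (big_setD1 (node_of M (e, false))) /=; last by rewrite in_setD1 bc nodeM.
rewrite mulrCA mulrA; congr (_ * _ * _); exact/genpoly_setD1/in_attached.
Qed.

(** At each end of [e] the only attached version of [e] has been deleted from the index set, and no
    other node has one. *)
Lemma edge_coefs_local M e x x' : normal_edge M e ->
  (forall g, g.1 != e -> x g = x' g) -> edge_coefs M e x = edge_coefs M e x'.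
Proof.
move=> ne xx'; have H i t : half_coef M e i t x = half_coef M e i t x'.
  apply: eq_genpoly => // -[d j]; rewrite in_setD1 => /andP[dji dj].
  apply: xx'; apply/eqP => /= de; rewrite de in dji dj.
  by rewrite attached_edgeE // in dj; rewrite (eqP dj) eqxx in dji.
rewrite /edge_coefs !H; congr sep_coef; apply: eq_bigr => a.
rewrite !inE => /and3P[ab ac _]; apply: eq_genpoly => // -[d j].
rewrite inE => /andP[_ /eqP dj]; apply: xx'; apply/eqP => /= de.
by move: dj ab ac; rewrite de => <-; case: j; rewrite eqxx.
Qed.

Lemma edge_coefsP M e : normal_edge M e ->
  has_coefs (hpoly M) e (edge_coefs M e).
Proof.
move=> ne; split=> x; first by move=> x'; apply: edge_coefs_local.
by move=> _; apply: hpoly_split.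
Qed.

Lemma hpoly_contract M e x : normal_edge M e ->
  hpoly (contract M e) x =
  (half_coef M e false false x * half_coef M e true false x
   + half_coef M e false true x * half_coef M e true true x)
  * rest_poly M e x.
Proof.
move=> ne; have /andP[eM bc] := ne.
set b := node_of M (e, false); set c := node_of M (e, true).
have bM : b \in nodes (contract M e).
  by rewrite [nodes _](nodes_contract ne) in_setD1 bc node_ofP.
rewrite /hpoly (big_setD1 b) //=; congr (_ * _); last first.
  rewrite [imset _ _](nodes_contract ne) -/b -/c; apply: eq_bigr => a.
  rewrite !inE => /and3P[ab ac _].
  rewrite [attached _ _](attached_contract_other ne) //.
  by apply: eq_bigr => s _; rewrite /contract_factor -/b (negPf ab).
rewrite [attached _ _](attached_contract ne) -/b -/c.
set A := attached M b :\ (e, false); set B := attached M c :\ (e, true).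
have nbc : (node_of M (e, false) == c) = false := negPf bc.
have ncb : (node_of M (e, true) == b) = false by rewrite eq_sym; exact: nbc.
have eA : ((attached M b :|: attached M c) :\: [set (e, false); (e, true)])
    = A :|: B.
  apply/setP=> g; rewrite !inE.
  case: (eqVneq g (e, false)) => [->|_] /=.
    by rewrite nbc !andbF.
  case: (eqVneq g (e, true)) => [->|_] //=.
  by rewrite ncb andbF.
have dAB : [disjoint A & B].
  rewrite -setI_eq0; apply/eqP/setP => g; rewrite !inE.
  case: (eqVneq (node_of M g) b) => [->|_]; last by rewrite !andbF.
  by rewrite nbc !andbF.
rewrite -/(genpoly _ (contract_factor M e b) x) eA.
(* For each value of the shared bit the merged factor is a product of a function of the trace on [A]
   and one of the trace on [B]. Traces on the full attached sets agree with these because [s] avoids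
   both versions of [e]. *)
have -> : genpoly (A :|: B) (contract_factor M e b) x =
    genpoly (A :|: B) (fun s =>
      factor M b (with_bit (s :&: A) (e, false) false) *
      factor M c (with_bit (s :&: B) (e, true) false) +
      factor M b (with_bit (s :&: A) (e, false) true) *
      factor M c (with_bit (s :&: B) (e, true) true)) x.
  apply: eq_genpoly => // s sAB.
  have [sb sc] : s :&: attached M b = s :&: A /\ s :&: attached M c = s :&: B.
    have nin i : (e, i) \notin s.
      by apply/negP => /(subsetP sAB); rewrite -eA !inE; case: i; rewrite eqxx ?orbT.
    by split; apply/setP=> g; rewrite /A /B in_setI [in RHS]in_setI in_setD1;
      case gs: (g \in s) => //=; case: eqVneq gs => // ->; rewrite (negPf (nin _)).
  by rewrite /contract_factor /= eqxx -/b -/c sb sc big_bool addrC.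
rewrite genpolyD.
rewrite (genpoly_setU (fun s => factor M b (with_bit s (e, false) false))
  (fun s => factor M c (with_bit s (e, true) false))) //.
by rewrite (genpoly_setU (fun s => factor M b (with_bit s (e, false) true))
  (fun s => factor M c (with_bit s (e, true) true))).
Qed.

Lemma half_coef_gt0 M e i t x :
  soft M -> normal_edge M e -> positive x -> 0 < half_coef M e i t x.
Proof.
move=> sM ne x0; apply: genpoly_gt0 => [s|g _]; last exact: x0.
rewrite subsetD1 => /andP[sA _]; apply: sM.
  by apply: node_ofP; case/andP: ne.
by case: t => //=; rewrite subUset sub1set in_attached.
Qed.

Lemma rest_poly_gt0 M e x : soft M -> positive x -> 0 < rest_poly M e x.
Proof.
move=> sM x0; apply: prodr_gt0 => a; rewrite !inE => /and3P[_ _ aM].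
by apply: genpoly_gt0 => [s|g _]; [apply: sM|apply: x0].
Qed.

Lemma soft_contract M e : soft M -> normal_edge M e -> soft (contract M e).
Proof.
move=> sM ne a s; have /andP[eM bc] := ne.
rewrite [nodes _](nodes_contract ne) in_setD1 => /andP[ac aM] sa /=.
rewrite /contract_factor /=; case: eqVneq => [_|ab]; last first.
  by apply: sM => //; rewrite -(attached_contract_other ne ab ac).
have pos i t : 0 < factor M (node_of M (e, i))
    (with_bit (s :&: attached M (node_of M (e, i))) (e, i) t).
  apply: sM; first exact: node_ofP.
  by case: t; rewrite /= ?subUset ?sub1set ?in_attached //= subsetIr.
by rewrite big_bool addr_gt0 ?mulr_gt0 ?pos.
Qed.

Lemma bp_gauge_edge_coefs M e x : soft M -> normal_edge M e -> positive x ->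
  bp_gauge (edge_coefs M e x) =
  (half_coef M e true true x / half_coef M e true false x,
   half_coef M e false true x / half_coef M e false false x).
Proof.
by move=> sM ne x0; rewrite bp_gauge_sep ?half_coef_gt0 ?rest_poly_gt0.
Qed.

Lemma bp_gauge_gt0 M e (c : (dedge E -> R) -> bicoef R) x :
  soft M -> normal_edge M e -> has_coefs (hpoly M) e c -> positive x ->
  0 < (bp_gauge (c x)).1 /\ 0 < (bp_gauge (c x)).2.
Proof.
move=> sM ne hc x0.
rewrite (has_coefs_unique (fun _ _ => erefl) hc (edge_coefsP ne) x0).
by rewrite bp_gauge_edge_coefs //= !divr_gt0 ?half_coef_gt0.
Qed.

Lemma bp_reduction_contract M e : soft M -> normal_edge M e ->
  bp_reduction (hpoly M) e (hpoly (contract M e)).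
Proof.
move=> sM ne; exists (edge_coefs M e); first exact: edge_coefsP.
move=> x x0 yz; rewrite (hpoly_split _ ne).
(* Substituting the gauge leaves the coefficients it was computed from unchanged. *)
have <- : edge_coefs M e x = edge_coefs M e (set_edge x e yz).
  by apply: edge_coefs_local => // g /negPf ge; rewrite /set_edge ge.
rewrite [yz]bp_gauge_edge_coefs // /set_edge !eqxx.
by rewrite bival_sep_gauge ?half_coef_gt0 // hpoly_contract.
Qed.

End Elimination.

Theorem mainTheorem4 (R : realType) (V E : finType) (M : multiGM R V E)
    (k : nat) (alpha : k.-tuple E)
    (hsoft : soft M)
    (hnormal : forall m : 'I_k,
        normal_edge (eliminate M (take m alpha)) (tnth alpha m))
    (hbouquet : bouquet (eliminate M alpha)) :
  (exists g : nat -> (dedge E -> R) -> R, bp_elimination M alpha g) /\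
  (forall g : nat -> (dedge E -> R) -> R, bp_elimination M alpha g ->
    forall m : nat, (m <= k)%N ->
    forall x : dedge E -> R, positive x ->
      g m x = hpoly (eliminate M (take m alpha)) x).
Proof.
pose Mm m := eliminate M (take m alpha).
have MmS (m : 'I_k) : Mm m.+1 = contract (Mm m) (tnth alpha m).
  rewrite /Mm (take_nth (tnth alpha m)) ?size_tuple //.
  by rewrite /eliminate foldl_rcons -tnth_nth.
have softM m : (m <= k)%N -> soft (Mm m).
  elim: m => [|m IHm] mk; first by rewrite /Mm take0.
  rewrite (MmS (Ordinal mk)); apply: soft_contract (hnormal _).
  exact/IHm/ltnW.
have red (m : 'I_k) :
    bp_reduction (hpoly (Mm m)) (tnth alpha m) (hpoly (Mm m.+1)).
  rewrite MmS; apply: bp_reduction_contract (hnormal _).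
  exact/softM/ltnW.
split.
  (* The exact polynomials themselves form a BP elimination, by [red]. *)
  by exists (fun m => hpoly (Mm m)); split=> // x _; rewrite /Mm take0.
move=> g [g0 gS]; elim=> [|m IHm] mk x x0; first by rewrite take0 g0.
pose i := Ordinal mk.
(* Both [g m.+1] and the exact polynomial are BP-reductions over the same edge, of functions that
   agree on positive arguments by induction. *)
apply: (bp_reduction_unique (IHm (ltnW mk)) _ (gS i) (red i)) => // c y.
exact: bp_gauge_gt0 (softM _ (ltnW mk)) (hnormal i).
Qed.
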